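(* Dirichlet's theorem on primes in arithmetic progressions (that is, the assertion that for all coprime integers $a$ and $b\ge1$ the progression $\{a+bk:k\in\mathbb N\}$ contains infinitely many prime numbers) holds if and only if $$\hat{\mathcal P}=\mathcal P\cup\hat{\mathbb Z}^*$$ is true, where $\hat{\mathcal P}$ is the closure of the set $\mathcal P$ of prime numbers in $\hat{\mathbb Z}$.
   Context: $\mathbb N=\{0,1,2,\dots\}$; $\mathcal P\subset\mathbb N$ is the set of prime numbers. $\hat{\mathbb Z}=\varprojlim_n\mathbb Z/n\mathbb Z$ is the profinite completion of $\mathbb Z$, with the profinite topology (the subspace topology from $\prod_{n\ge1}\mathbb Z/n\mathbb Z$, each factor being discrete), and $\hat{\mathbb Z}^*$ is its group of units. $\mathbb Z$ is identified with its image in $\hat{\mathbb Z}$ under the natural injection $x\mapsto(x\bmod n)_n$, so that $\mathcal P\subset\mathbb Z\subset\hat{\mathbb Z}$. *)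

(* Defs.v *)
From HB Require Import structures.
From mathcomp Require Import all_boot all_order all_algebra.
From mathcomp Require Import all_classical topology.

Set Implicit Arguments.
Unset Strict Implicit.
Unset Printing Implicit Defensive.

Import Order.TTheory GRing.Theory Num.Theory.

Local Open Scope classical_set_scope.
Local Open Scope ring_scope.

(* 'I_n.+1 carries addition and multiplication modulo n + 1, so coordinate n  *)
(* is a residue modulo n + 1 and n : nat ranges over exactly the moduli >= 1  *)
(* ('Z_n would not do: 'Z_1 is Z/2Z).                                         *)
Local Notation residues := (prod_topology (fun n => discrete_topology 'I_n.+1)).

Definition coherent : set residues :=
  [set x : residues | forall m n : nat, (m.+1 %| n.+1)%N ->
    inZp (x n : 'I_n.+1) = x m :> 'I_m.+1].

(* The library's topology on set_type is the subspace topology. *)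
Definition Zhat : Type := set_type coherent.

HB.instance Definition _ := Topological.copy Zhat (set_type coherent).

Definition Zhat_coord (x : Zhat) (n : nat) : 'I_n.+1 := set_val x n.

Lemma Zhat_coherent (x : Zhat) (m n : nat) : (m.+1 %| n.+1)%N ->
  inZp (Zhat_coord x n) = Zhat_coord x m.
Proof. by rewrite /Zhat_coord; case: x => x xc /=; exact: (set_mem xc). Qed.

Lemma ZhatP (x y : Zhat) : (forall n, Zhat_coord x n = Zhat_coord y n) -> x = y.
Proof. by move=> xy; apply/val_inj/functional_extensionality_dep. Qed.

Definition mkZhat (f : forall n : nat, 'I_n.+1)
    (fc : forall m n : nat, (m.+1 %| n.+1)%N -> inZp (f n) = f m) : Zhat :=
  @SigSub _ _ coherent (f : residues) (mem_set fc).

Fact Zhat_zero_subproof (m n : nat) : (m.+1 %| n.+1)%N ->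
  inZp (Zp0 : 'I_n.+1) = Zp0 :> 'I_m.+1.
Proof. by move=> mn; apply/val_inj; rewrite /= mod0n. Qed.

Fact Zhat_one_subproof (m n : nat) : (m.+1 %| n.+1)%N ->
  inZp (Zp1 : 'I_n.+1) = Zp1 :> 'I_m.+1.
Proof. by move=> mn; apply/val_inj; rewrite /= modn_dvdm. Qed.

Fact Zhat_opp_subproof (x : Zhat) (m n : nat) : (m.+1 %| n.+1)%N ->
  inZp (Zp_opp (Zhat_coord x n)) = Zp_opp (Zhat_coord x m).
Proof.
have opp_mod a M N : (M %| N)%N -> (0 < M)%N -> (a < N)%N ->
    N - a = M - a %% M %[mod M].
  move=> MN M0 aN; apply/eqP; rewrite -(eqn_modDr a) (subnK (ltnW aN)).
  by rewrite -(modnDmr (M - _)) subnK ?modnn // ltnW // ltn_mod.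
move=> mn; apply/val_inj; rewrite -(Zhat_coherent x mn).
by rewrite /= modn_dvdm //; exact: opp_mod.
Qed.

Fact Zhat_add_subproof (x y : Zhat) (m n : nat) : (m.+1 %| n.+1)%N ->
  inZp (Zp_add (Zhat_coord x n) (Zhat_coord y n)) =
  Zp_add (Zhat_coord x m) (Zhat_coord y m).
Proof.
move=> mn; apply/val_inj; rewrite -(Zhat_coherent x mn) -(Zhat_coherent y mn).
by rewrite /= modn_dvdm // modnDm.
Qed.

Fact Zhat_mul_subproof (x y : Zhat) (m n : nat) : (m.+1 %| n.+1)%N ->
  inZp (Zp_mul (Zhat_coord x n) (Zhat_coord y n)) =
  Zp_mul (Zhat_coord x m) (Zhat_coord y m).
Proof.
move=> mn; apply/val_inj; rewrite -(Zhat_coherent x mn) -(Zhat_coherent y mn).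
by rewrite /= modn_dvdm // modnMm.
Qed.

Definition Zhat_zero : Zhat := mkZhat Zhat_zero_subproof.
Definition Zhat_one : Zhat := mkZhat Zhat_one_subproof.
Definition Zhat_opp (x : Zhat) : Zhat := mkZhat (@Zhat_opp_subproof x).
Definition Zhat_add (x y : Zhat) : Zhat := mkZhat (@Zhat_add_subproof x y).
Definition Zhat_mul (x y : Zhat) : Zhat := mkZhat (@Zhat_mul_subproof x y).

Fact Zhat_addA : associative Zhat_add.
Proof. by move=> x y z; apply/ZhatP => n; exact: Zp_addA. Qed.
Fact Zhat_addC : commutative Zhat_add.
Proof. by move=> x y; apply/ZhatP => n; exact: Zp_addC. Qed.
Fact Zhat_add0 : left_id Zhat_zero Zhat_add.
Proof. by move=> x; apply/ZhatP => n; exact: Zp_add0z. Qed.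
Fact Zhat_addN : left_inverse Zhat_zero Zhat_opp Zhat_add.
Proof. by move=> x; apply/ZhatP => n; exact: Zp_addNz. Qed.

HB.instance Definition _ :=
  GRing.isZmodule.Build Zhat Zhat_addA Zhat_addC Zhat_add0 Zhat_addN.

Fact Zhat_mulA : associative Zhat_mul.
Proof. by move=> x y z; apply/ZhatP => n; exact: Zp_mulA. Qed.
Fact Zhat_mulC : commutative Zhat_mul.
Proof. by move=> x y; apply/ZhatP => n; exact: Zp_mulC. Qed.
Fact Zhat_mul1 : left_id Zhat_one Zhat_mul.
Proof. by move=> x; apply/ZhatP => n; exact: Zp_mul1z. Qed.
Fact Zhat_mulDl : left_distributive Zhat_mul Zhat_add.
Proof. by move=> x y z; apply/ZhatP => n; exact: Zp_mul_addl. Qed.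
Fact Zhat_one_neq0 : Zhat_one != 0 :> Zhat.
Proof. by apply/eqP => /(congr1 (fun x : Zhat => val (Zhat_coord x 1))). Qed.

HB.instance Definition _ := GRing.Zmodule_isComNzRing.Build Zhat
  Zhat_mulA Zhat_mulC Zhat_mul1 Zhat_mulDl Zhat_one_neq0.

Definition Zhat_unit : pred Zhat := fun x => `[< exists y : Zhat, y * x = 1 >].

(* The inverse of a non-unit x is x itself, as unitRingType demands. *)
Definition Zhat_inv (x : Zhat) : Zhat := xget x [set y | y * x = 1].

Fact Zhat_mulV : {in Zhat_unit, left_inverse 1 Zhat_inv *%R}.
Proof. by move=> x /asboolP[y yx]; rewrite /Zhat_inv; case: xgetP => // /(_ y). Qed.
Fact Zhat_unitP (x y : Zhat) : y * x = 1 -> Zhat_unit x.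
Proof. by move=> yx; apply/asboolP; exists y. Qed.
Fact Zhat_inv_out : {in [predC Zhat_unit], Zhat_inv =1 id}.
Proof.
move=> x; rewrite inE => /asboolP xN; rewrite /Zhat_inv.
by case: xgetP => // y _ yx; case: xN; exists y.
Qed.

HB.instance Definition _ := GRing.ComNzRing_hasMulInverse.Build Zhat
  Zhat_mulV Zhat_unitP Zhat_inv_out.

Fact int_mod_subproof (x : int) (n : nat) : (`|(x %% n.+1)%Z| < n.+1)%N.
Proof. by rewrite -ltz_nat gez0_abs ?modz_ge0 // ltz_mod. Qed.

(* The residue of x modulo n + 1, which is nonnegative also for x < 0. *)
Definition int_mod (x : int) (n : nat) : 'I_n.+1 :=
  Ordinal (int_mod_subproof x n).

Fact int_mod_coherent (x : int) (m n : nat) : (m.+1 %| n.+1)%N ->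
  inZp (int_mod x n) = int_mod x m.
Proof.
move=> /dvdnP[k nkm]; apply/val_inj/eqP; rewrite /= -eqz_nat -modz_nat.
rewrite !gez0_abs ?modz_ge0 //; apply/eqP.
rewrite [in RHS](divz_eq x n.+1) [in X in (_ * X + _)%R]nkm PoszM mulrA.
by rewrite modzMDl.
Qed.

Definition int_Zhat (x : int) : Zhat := mkZhat (@int_mod_coherent x).

Definition primesZ : set int := [set p%:Z | p in [set p : nat | prime p]].

Definition primesZhat : set Zhat := int_Zhat @` primesZ.

Definition Zhat_units : set Zhat := [set x : Zhat | x \is a GRing.unit].

Definition Dirichlet_theorem : Prop :=
  forall a b : int, coprimez a b -> 1 <= b ->
    infinite_set ([set a + b * k%:Z | k in [set: nat]] `&` primesZ).

Lemma int_Zhat_inj : injective int_Zhat.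
Proof.
move=> x y xy; pose n := `|(x - y)%R|%N.
have /(congr1 (fun z : Zhat => (val (Zhat_coord z n))%:Z)) /= := xy.
rewrite !gez0_abs ?modz_ge0 // => /eqP; rewrite eqz_mod_dvd => nxy.
apply/eqP; rewrite -subr_eq0 -absz_eq0; apply/eqP; apply: contraTeq nxy => nz.
by rewrite dvdzE /= gtnNdvd // lt0n.
Qed.

Lemma int_ZhatE (x : int) : int_Zhat x = x%:~R.
Proof.
have D y z : int_Zhat (y + z) = int_Zhat y + int_Zhat z.
  apply/ZhatP => n; apply/val_inj/eqP.
  rewrite /= -eqz_nat -modz_nat PoszD !gez0_abs ?modz_ge0 //.
  by rewrite modzDm.
have I0 : int_Zhat 0 = 0 by apply: (addrI (int_Zhat 0)); rewrite -D !addr0.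
have N y : int_Zhat (- y) = - int_Zhat y.
  by apply/eqP; rewrite -addr_eq0 -D addNr I0.
have I1 : int_Zhat 1 = 1.
  by apply/ZhatP => n; apply/val_inj; rewrite /= modz_nat.
elim/int_rect: x => [//|n IH|n IH]; first by rewrite -addn1 PoszD D IH I1 rmorphD.
by rewrite -addn1 PoszD opprD D IH !N I1 rmorphB /= rmorphN.
Qed.

(* Main.v *)
(* A point x is in the closure of A iff for every n some element of A agrees  *)
(* with x modulo n. A non-unit x is 0 modulo some prime p, and a prime that    *)
(* agrees with x modulo a multiple of p can only be p, so x = p. Conversely, a *)
(* residue a coprime to b lifts to a unit u of Zhat, and a prime that agrees   *)
(* with u modulo b * K! is congruent to a modulo b and exceeds K.              *)

Require Import Defs.
From mathcomp Require Import all_boot all_order all_algebra.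
From mathcomp Require Import all_classical topology.
From mathcomp Require Import zify ring.
Local Open Scope classical_set_scope.
Local Open Scope ring_scope.

Import Order.TTheory GRing.Theory Num.Theory.

(** Both sides are tested one modulus at a time: membership in a closure by [closure_ZhatP],
    invertibility by [Zhat_unit_coordP]. A unit is a coherent system of residues coprime to their
    moduli, so it is a limit of primes once each such class contains a prime, which Dirichlet
    supplies. A non-unit vanishes modulo some prime p, and the only prime near it is p. For the
    converse, [Zhat_unit_lift] extends a coprime class to a unit; primes near that unit lie in the
    class, and they are arbitrarily large because closeness modulo K! makes them coprime to K!. *)

Local Notation residues := (prod_topology (fun n => discrete_topology 'I_n.+1)).

Lemma closure_ZhatP (A : set Zhat) (x : Zhat) :
  closure A x <-> forall n, exists2 y, A y & Zhat_coord y n = Zhat_coord x n.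
Proof.
split=> [clAx n|Ax].
  have cont : continuous (fun y : Zhat => Zhat_coord y n : discrete_topology 'I_n.+1).
    move=> y.
    apply: (@continuous_comp _ _ _ (set_val : Zhat -> _)
              (proj n : residues -> _)).
      exact: initial_continuous.
    exact: proj_continuous.
  have [y [Ay yx]] := clAx _ (cont x _ (discrete_set1 _)).
  by exists y.
(* Index k! - 1 means modulus k!, a multiple of every n + 1 <= k: each coordinate of [a k] is
   eventually that of x. *)
pose a k : Zhat := projT1 (cid2 (Ax (k`!).-1)).
have aA k : A (a k) by rewrite /a; case: cid2.
have ax n k : (n < k)%N -> Zhat_coord (a k) n = Zhat_coord x n.
  move=> nk.
  have nk1 : (n.+1 %| (k`!).-1.+1)%N by rewrite prednK ?fact_gt0 // dvdn_fact.
  rewrite -(Zhat_coherent (a k) nk1) -(Zhat_coherent x nk1).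
  by rewrite /a; case: cid2 => y /= _ ->.
have acvg : (fun k => set_val (a k) : residues) @ \oo --> (set_val x : residues).
  apply/cvg_sup => n U [V] [[W] oW <-] /= Wx WU; apply: filterS WU _.
  exists n.+1 => //= k nk; rewrite /= -/(Zhat_coord (a k) n) ax //.
move=> B [_ [[C oC <-] Cx CB]].
have [N _ NC] := acvg _ (open_nbhs_nbhs (conj oC Cx)).
exists (a N); split; [exact: aA|exact: CB (NC N (leqnn N))].
Qed.

Lemma prime_common_divisor (m n : nat) : (0 < m)%N -> ~~ coprime m n ->
  exists2 p, prime p & (p %| m)%N && (p %| n)%N.
Proof.
move=> m0 mn; exists (pdiv (gcdn m n)); last by rewrite -dvdn_gcd pdiv_dvd.
by apply: pdiv_prime; rewrite ltn_neqAle eq_sym mn gcdn_gt0 m0.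
Qed.

Lemma int_modP (n : nat) (x y : int) :
  int_mod x n = int_mod y n <-> (x = y %[mod n.+1])%Z.
Proof.
split=> [/(congr1 (fun z : 'I_n.+1 => (val z)%:Z)) /=|xy].
  by rewrite !gez0_abs ?modz_ge0.
by apply/val_inj; rewrite /= xy.
Qed.

Lemma coprime_int_mod (n : nat) (x : int) :
  coprime n.+1 (int_mod x n) = coprimez n.+1 x.
Proof.
by rewrite /coprimez -gcdz_modr /gcdz /= eqz_nat.
Qed.

(** Inverses taken coordinatewise are coherent because an inverse modulo m + 1 is unique. *)
Lemma Zhat_unit_coordP (x : Zhat) :
  x \is a GRing.unit <-> forall n, coprime n.+1 (Zhat_coord x n).
Proof.
split=> [/mulVr yx n|xc].
  have /(congr1 (fun z : Zhat => val (Zhat_coord z n))) /= e := yx.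
  suff : coprime n.+1 (Zhat_coord x^-1 n * Zhat_coord x n).
    by rewrite coprimeMr => /andP[].
  by rewrite -coprime_modr e coprime_modr coprimen1.
have yc m n : (m.+1 %| n.+1)%N ->
    inZp (Zp_inv (Zhat_coord x n)) = Zp_inv (Zhat_coord x m).
  move=> mn; set y := inZp _.
  have yx : Zp_mul y (Zhat_coord x m) = Zp1.
    have /(congr1 (fun z : 'I_n.+1 => inZp z : 'I_m.+1)) := Zp_mulVz (xc n).
    rewrite -(Zhat_coherent x mn) => e; apply: etrans (etrans e _).
      by apply/val_inj; rewrite /= modn_dvdm // modnMm.
    by apply/val_inj; rewrite /= modn_dvdm.
  rewrite -[y](@Zp_mulz1 m) -(Zp_mulzV (xc m)) Zp_mulA yx; exact: Zp_mul1z.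
apply/unitrPr; exists (mkZhat yc); apply/ZhatP => n; exact: Zp_mulzV.
Qed.

(** Pigeonhole: the m + 2 powers with exponents 0, ..., m + 1 take at most m + 1 residues. *)
Lemma expz_eventually_periodic (c : int) (m : nat) :
  exists i d : nat, [/\ (i <= m)%N, (0 < d <= m.+1)%N &
    forall k t, (i <= k)%N -> (c ^+ (k + t * d)%N = c ^+ k %[mod m.+1])%Z].
Proof.
pose f (i : 'I_m.+2) := int_mod (c ^+ i) m.
have [i [j [ij fij]]] : exists i j : 'I_m.+2, (i < j)%N /\ f i = f j.
  have : ~~ injectiveb f.
    by apply/injectiveP => /leq_card; rewrite !card_ord ltnn.
  case/injectivePn => i [j ij fij].
  by case: (ltngtP i j) => // [ltij|ltji|/val_inj eij];
    [exists i, j|exists j, i|rewrite eij eqxx in ij].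
exists i, (j - i)%N; split; [have := ltn_ord j; lia|have := ltn_ord j; lia|].
move=> k t ik; elim: t => [|t <-]; first by rewrite mul0n addn0.
have -> : (k + t.+1 * (j - i) = (k - i + t * (j - i)) + j)%N by lia.
have -> : (k + t * (j - i) = (k - i + t * (j - i)) + i)%N by lia.
move/int_modP: fij => fij.
by rewrite ![c ^+ (_ + _)%N]exprD -modzMmr -fij modzMmr.
Qed.

(** Makes c ^ k! converge in [Zhat]: both exponents are multiples of the period d <= k and lie
    beyond the preperiod, as k! >= k > m. *)
Lemma expz_fact_mod (c : int) (m k l : nat) : (m < k)%N -> (k <= l)%N ->
  (c ^+ l`! = c ^+ k`! %[mod m.+1])%Z.
Proof.
move=> mk kl; have [i [d [im /andP[d0 dm] per]]] := expz_eventually_periodic c m.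
have dk : (d %| k`!)%N by apply: dvdn_fact; rewrite d0; lia.
have dl : (d %| l`!)%N by apply: dvdn_fact; rewrite d0; lia.
have kl' : (k`! <= l`!)%N by exact: leq_fact.
rewrite -(subnKC kl') -[(l`! - k`!)%N](@divnK d) ?dvdn_sub // per //.
have := fact_geq k; lia.
Qed.

(** Makes the limit of c ^ k! idempotent: k! is a multiple of the period. *)
Lemma expz_fact_idem (c : int) (m k : nat) : (m < k)%N ->
  (c ^+ (k`! + k`!)%N = c ^+ k`! %[mod m.+1])%Z.
Proof.
move=> mk; have [i [d [im /andP[d0 dm] per]]] := expz_eventually_periodic c m.
have dk : (d %| k`!)%N by apply: dvdn_fact; rewrite d0; lia.
rewrite -{2}(divnK dk) per //.
have := fact_geq k; lia.
Qed.

(* [u = c + b.+1 * (1 - e)], where the idempotent [e = lim c ^+ k`!] is 0 at  *)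
(* the primes dividing [c] and 1 at the others.                               *)
Lemma Zhat_unit_lift (c : int) (b : nat) : coprimez c b.+1 ->
  exists2 u : Zhat, u \is a GRing.unit & Zhat_coord u b = int_mod c b.
Proof.
move=> cb; pose v n : int := c + b.+1%:Z * (1 - c ^+ (n.+1)`!).
have vc m n : (m.+1 %| n.+1)%N -> inZp (int_mod (v n) n) = int_mod (v m) m.
  move=> mn; rewrite int_mod_coherent //; apply/int_modP; rewrite /v.
  apply/eqP; rewrite eqz_mod_dvd.
  have -> : c + b.+1%:Z * (1 - c ^+ (n.+1)`!) - (c + b.+1%:Z * (1 - c ^+ (m.+1)`!))
          = - b.+1%:Z * (c ^+ (n.+1)`! - c ^+ (m.+1)`!) by ring.
  rewrite dvdz_mull // -eqz_mod_dvd; apply/eqP.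
  by apply: expz_fact_mod => //; exact: dvdn_leq.
exists (mkZhat vc); last first.
  by apply/int_modP; rewrite /v mulrC addrC modzMDl.
apply/Zhat_unit_coordP => n; rewrite [Zhat_coord _ _]/(int_mod (v n) n).
rewrite coprime_int_mod coprimezE /=; apply: contraT => ncop.
have [p pp /andP[pn pv]] := prime_common_divisor _ _ (ltn0Sn n) ncop.
have {}pv : (p %| v n)%Z by rewrite dvdzE.
(* If p divided c, the power of c would vanish modulo p, so p would divide b + 1 as well. *)
have pc : ~~ (p %| c)%Z.
  apply/negP => pc.
  have pcM : (p %| c ^+ (n.+1)`!)%Z by rewrite dvdz_exp ?fact_gt0.
  have pb : (p %| b.+1%:Z)%Z.
    have -> : b.+1%:Z = v n - c + b.+1%:Z * c ^+ (n.+1)`! by rewrite /v; ring.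
    by apply: rpredD; [apply: rpredB|rewrite dvdz_mull].
  have : (p %| gcdz c b.+1)%Z by rewrite dvdz_gcd pc pb.
  by rewrite (eqP cb) dvdzE /= Euclid_dvd1.
(* Modulo p the idempotent is 0 or 1, and 0 is excluded since p does not divide c; hence v n = c
   modulo p, a contradiction. *)
have pe : (p %| 1 - c ^+ (n.+1)`!)%Z.
  have : (p %| c ^+ (n.+1)`! * (1 - c ^+ (n.+1)`!))%Z.
    apply: (@dvdz_trans n.+1) => //.
    have /esym/eqP := expz_fact_idem c n n.+1 (leqnn _).
    by rewrite eqz_mod_dvd exprD mulrBr mulr1.
  rewrite dvdzE abszM Euclid_dvdM // abszX Euclid_dvdX // => /orP[/andP[pc']|//].
  by rewrite dvdzE pc' in pc.
case/negP: pc; have -> : c = v n - b.+1%:Z * (1 - c ^+ (n.+1)`!) by rewrite /v; ring.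
by apply: rpredB => //; rewrite dvdz_mull.
Qed.

Theorem theorem3p27 :
  Dirichlet_theorem <-> closure primesZhat = primesZhat `|` Zhat_units.
Proof.
split=> [dir|clP a b ab b1].
  apply/seteqP; split=> [x /closure_ZhatP clx|x].
    have [xu|xN] := boolP (x \is a GRing.unit); [by right|left].
    have [n nx] : exists n, ~~ coprime n.+1 (Zhat_coord x n).
      apply: contrapT => H; move/negP: xN; apply; apply/Zhat_unit_coordP => n.
      by apply: contrapT => /negP nx; apply: H; exists n.
    have [p pp /andP[pn px]] := prime_common_divisor _ _ (ltn0Sn n) nx.
    exists p%:Z; first by exists p.
    (* A prime q that agrees with x modulo (n + 1)(m + 1) is divisible by p, through n + 1, so q =
       p; then m + 1 gives coordinate m. *)
    apply/ZhatP => m; pose N := (n.+1 * m.+1).-1.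
    have NE : N.+1 = (n.+1 * m.+1)%N by [].
    have nN : (n.+1 %| N.+1)%N by rewrite NE dvdn_mulr.
    have mN : (m.+1 %| N.+1)%N by rewrite NE dvdn_mull.
    have [_ [_ [q qp <-] <-] qx] := clx N.
    suff -> : p = q by rewrite -(Zhat_coherent x mN) -qx int_mod_coherent.
    have : (p %| Zhat_coord (int_Zhat q) n)%N.
      by rewrite -(Zhat_coherent _ nN) qx Zhat_coherent.
    rewrite /= modz_nat /= /dvdn modn_dvdm // -/(dvdn p q).
    by rewrite dvdn_prime2 // => /eqP.
  case=> [Px|/Zhat_unit_coordP xu]; first exact: subset_closure.
  apply/closure_ZhatP => n.
  have /dir/(_ isT)/infinite_setN0 : coprimez (Zhat_coord x n) n.+1.
    by rewrite coprimezE coprime_sym; exact: xu.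
  case=> _ [[k _ <-] [p pp pE]].
  exists (int_Zhat p%:Z); first by exists p%:Z => //; exists p.
  apply/val_inj; rewrite /= pE addrC mulrC modzMDl modz_nat /=.
  by rewrite modn_small.
case/finite_seqP => s sE.
case: b b1 ab sE => // -[//|b] _ ab sE.
have [u uu ua] := Zhat_unit_lift _ _ ab.
(* K bounds |a| and every member of the supposedly finite set s. *)
pose K := (`|a| + \sum_(x <- s) `|x|)%N.
pose N := (b.+1 * K`!).-1.
have NE : N.+1 = (b.+1 * K`!)%N by rewrite prednK // muln_gt0 fact_gt0.
have bN : (b.+1 %| N.+1)%N by rewrite NE dvdn_mulr.
have /closure_ZhatP/(_ N)[_ [_ [p pp <-] <-] pu] : closure primesZhat u.
  by rewrite clP; right.
have Kp : (K < p)%N.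
  rewrite ltnNge; apply/negP => pK.
  move/Zhat_unit_coordP: uu => /(_ N); rewrite -pu coprime_int_mod coprimezE /=.
  by rewrite coprime_sym prime_coprime // NE dvdn_mull // dvdn_fact // prime_gt0.
have pa : (p%:Z = a %[mod b.+1])%Z.
  apply/int_modP; rewrite -ua -(Zhat_coherent u bN) -pu.
  by rewrite int_mod_coherent.
(* Ensures that the index k of p in the progression is nonnegative. *)
have ap : a <= p%:Z by rewrite /K in Kp; lia.
have : p%:Z \in s.
  suff : [set` s] p%:Z by [].
  rewrite -sE; split; last by exists p.
  move/eqP: pa; rewrite eqz_mod_dvd => /dvdzP[k kE].
  exists `|k|%N => //; rewrite gez0_abs; last by nia.
  by rewrite mulrC -kE addrC subrK.
move=> ps; move: Kp; rewrite /K (big_rem _ ps) /=; lia.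
Qed.
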